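(* Let $\mathbb{T}=\{0,\ldots,T\}$ with $0\le T<\infty$. The system of reflected backward stochastic difference equations: for all $i\in\mathcal{I}$, $$\begin{cases} Y^i_t = \min_{j\in\mathcal{I}}\rho_T(\tilde g_{i,j}(T))+\sum_{s=t}^{T-1}\rho_s(g_{i}(s)+\Delta M^i_{s+1})-(M^i_T-M^i_t)-(A^i_{T}-A^i_t),\quad\forall\, t\in\mathbb{T},\\ Y^i_t \le \min_{j\in\mathcal{I}\setminus\{i\}} \rho_t(\tilde g_{i,j}(t)+Y^j_{t+1}),\quad\forall\, t\in\mathbb{T},\\ \sum_{t=0}^{T-1}\big(Y^i_t - \min_{j\in\mathcal{I}\setminus\{i\}} \rho_t(\tilde g_{i,j}(t)+Y^j_{t+1})\big)\Delta A^i_{t+1}=0, \end{cases}$$ (with $Y^j_{T+1}:=0$) has a unique solution $(Y,M,A)$. Furthermore $Y=V$, where $V=(V^i)_{i\in\mathcal{I}}$ is the value process of the finite-horizon optimal switching problem, $$V_t^{i} = \operatorname*{ess\,inf}_{\xi\in\mathcal{U}^i_t}\rho_{t,T}\big(\tilde g_{\xi_{t-1},\xi_t}(t),\ldots,\tilde g_{\xi_{T-1},\xi_{T}}(T)\big).$$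
   Context: $(\Omega,\mathcal{F},\mathbb{P})$ is a probability space and $\mathbb{G}=\{\mathcal{G}_t\}_{t\in\mathbb{T}}$ is a filtration of sub-$\sigma$-algebras of $\mathcal{F}$. $L^\infty_{\mathcal{H}}$ denotes the space of essentially bounded $\mathcal{H}$-measurable random variables. All (in)equalities between random variables are $\mathbb{P}$-almost sure. A $\mathbb{G}$-conditional risk mapping is a family $\rho=\{\rho_t\}_{t\in\mathbb{T}}$, $\rho_t:L^\infty_{\mathcal{F}}\to L^\infty_{\mathcal{G}_t}$, satisfying for all $t$: normalisation $\rho_t(0)=0$; conditional translation invariance $\rho_t(Z+W)=Z+\rho_t(W)$ for $W\in L^\infty_{\mathcal{F}}$, $Z\in L^\infty_{\mathcal{G}_t}$; monotonicity: $W\le Z$ implies $\rho_t(W)\le\rho_t(Z)$ for $W,Z\in L^\infty_{\mathcal F}$. Such a $\rho$ is fixed. The aggregated risk mapping is $\rho_{t,t}(W_t)=\rho_t(W_t)$ and, for $s<t$, $\rho_{s,t}(W_s,\ldots,W_t)=\rho_s\big(W_s+\rho_{s+1}(W_{s+1}+\cdots+\rho_{t-1}(W_{t-1}+\rho_t(W_t))\cdots)\big)$. $\mathcal{I}=\{1,\ldots,m\}$ is a finite set of modes; $g_i(t)$ and $c_{i,j}(t)$ ($i,j\in\mathcal{I}$, $t\in\mathbb{T}$) are random variables in $L^\infty_{\mathcal{F}}$ (not assumed $\mathbb{G}$-adapted) with $c_{i,i}(t)=0$, and $\tilde g_{i,j}(t)=g_j(t)+c_{i,j}(t)$. A strategy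 is an $\mathcal{I}$-valued, $\mathbb{G}$-adapted random sequence $\xi=(\xi_t)_{t\in\{-1\}\cup\mathbb{T}}$ (with $\xi_{-1}$ the initial mode), and $\mathcal{U}^i_t$ is the set of strategies with $\xi_{t-1}=i$. $\Delta X_{t+1}=X_{t+1}-X_t$. Let $\mathcal{L}^\infty_{\mathbb{G},T}=\otimes_{t=0}^T L^\infty_{\mathcal{G}_t}$ (sequences $(W_t)_{t=0}^T$ with $W_t\in L^\infty_{\mathcal{G}_t}$); for $\mathbb{R}^m$-valued processes membership and all properties are understood component-wise. A process $M\in\mathcal{L}^\infty_{\mathbb{G},T}$ is a $\rho_{s,t}$-martingale if $M_s=\rho_{s,t}(0,\ldots,0,M_t)$ for all $0\le s\le t\le T$. A process $A$ is $\mathbb{G}$-predictable if $A_{t+1}$ is $\mathcal{G}_t$-measurable for all $t$ (and $A_0$ is constant). A solution of the system is a triple $(Y,M,A)\in(\mathcal{L}^\infty_{\mathbb{G},T})^3$ of $\mathbb{G}$-adapted $\mathbb{R}^m$-valued processes such that $M$ is a $\rho_{s,t}$-martingale, $A$ is non-decreasing and $\mathbb{G}$-predictable, $M_0=A_0=0$, and the system holds. It is unique if any other solution is indistinguishable from it. Conventions: $\min\emptyset=\infty$ and $\pm\infty\cdot 0=0$. *)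

(* Defs.v *)
From HB Require Import structures.
From mathcomp Require Import all_boot all_order all_algebra.
From mathcomp Require Import all_classical all_reals all_analysis measurable_realfun.

Set Implicit Arguments.
Unset Strict Implicit.
Unset Printing Implicit Defensive.

Import Order.TTheory GRing.Theory Num.Theory.

Local Open Scope classical_set_scope.
Local Open Scope ring_scope.

(* Elements of L^oo spaces are represented by functions, and every (in)equality
   between them is imposed P-almost surely. Time is indexed by nat, and every
   condition is imposed only for times in {0, ..., T}; the values of the data
   at later times play no role. *)
Section definitions.
Context {R : realType} {d : measure_display} {Omega : measurableType d}.
Variable P : probability Omega R.
Implicit Types (X Z W : Omega -> R).

Definition sub_sigma_algebra (H : set_system Omega) :=
  sigma_algebra [set: Omega] H /\ H `<=` measurable.

Definition filtration (T : nat) (G : nat -> set_system Omega) :=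
  (forall t, (t <= T)%N -> sub_sigma_algebra (G t)) /\
  (forall s t, (s <= t <= T)%N -> G s `<=` G t).

(* [g_sigma_algebraType H] is Omega equipped with the sigma-algebra generated
   by H, which is H itself when H is a sigma-algebra. *)
Definition measurable_wrt (H : set_system Omega) X :=
  measurable_fun [set: g_sigma_algebraType H] X.

Definition Linfty : set (Omega -> R) := [set X | X \in Lfun P +oo%E].

Definition Linfty_wrt (H : set_system Omega) : set (Omega -> R) :=
  [set X | Linfty X /\ measurable_wrt H X].

(* That rho t is well defined on a.s. equality classes follows from [crm_mono],
   whose hypothesis is an almost sure inequality. *)
Record cond_risk_mapping (T : nat) (G : nat -> set_system Omega)
    (rho : nat -> (Omega -> R) -> (Omega -> R)) : Prop := CondRiskMapping {
  crm_codom : forall t W, (t <= T)%N -> Linfty W -> Linfty_wrt (G t) (rho t W) ;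
  crm_norm : forall t, (t <= T)%N ->
    \forall w \ae P, rho t (cst 0) w = 0 ;
  crm_trans : forall t Z W, (t <= T)%N -> Linfty_wrt (G t) Z -> Linfty W ->
    \forall w \ae P, rho t (Z \+ W) w = Z w + rho t W w ;
  crm_mono : forall t W Z, (t <= T)%N -> Linfty W -> Linfty Z ->
    (\forall w \ae P, W w <= Z w) ->
    \forall w \ae P, rho t W w <= rho t Z w }.

Fixpoint agg_risk_rec (rho : nat -> (Omega -> R) -> (Omega -> R)) (n s : nat)
    (W : nat -> Omega -> R) : Omega -> R :=
  if n is k.+1 then rho s (W s \+ agg_risk_rec rho k s.+1 W) else rho s (W s).

(* rho_{s,t}(W_s, ..., W_t), meaningful for s <= t *)
Definition agg_risk rho (s t : nat) (W : nat -> Omega -> R) : Omega -> R :=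
  agg_risk_rec rho (t - s) s W.

Definition bounded_adapted (T : nat) (G : nat -> set_system Omega)
    (X : nat -> Omega -> R) :=
  forall t, (t <= T)%N -> Linfty_wrt (G t) (X t).

Definition risk_martingale (T : nat) rho (M : nat -> Omega -> R) :=
  forall s t, (s <= t <= T)%N ->
    \forall w \ae P,
      M s w = agg_risk rho s t (fun u => if u == t then M t else cst 0) w.

Definition predictable (T : nat) (G : nat -> set_system Omega)
    (A : nat -> Omega -> R) :=
  (exists a : R, \forall w \ae P, A 0%N w = a) /\
  (forall t, (t < T)%N -> measurable_wrt (G t) (A t.+1)).

Definition nondecreasing_process (T : nat) (A : nat -> Omega -> R) :=
  forall t, (t < T)%N -> \forall w \ae P, A t w <= A t.+1 w.

Definition increment (X : nat -> Omega -> R) (t : nat) : Omega -> R :=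
  X t.+1 \- X t.

Definition indistinguishable (m T : nat) (X X' : 'I_m -> nat -> Omega -> R) :=
  \forall w \ae P, forall i t, (t <= T)%N -> X i t w = X' i t w.

(* essential infimum of a family of random variables, which is unique up to
   a.s. equality: a largest (extended) random variable below the family *)
Definition is_ess_infimum (Phi : set (Omega -> R)) X :=
  [/\ measurable_fun [set: Omega] X,
      forall W, Phi W -> \forall w \ae P, X w <= W w
    & forall Z : Omega -> \bar R, measurable_fun [set: Omega] Z ->
        (forall W, Phi W -> \forall w \ae P, (Z w <= (W w)%:E)%E) ->
        \forall w \ae P, (Z w <= (X w)%:E)%E].

Section switching.
Variables (T m : nat) (G : nat -> set_system Omega).
Variable rho : nat -> (Omega -> R) -> (Omega -> R).
Variables (g : 'I_m -> nat -> Omega -> R) (c : 'I_m -> 'I_m -> nat -> Omega -> R).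

Definition gtilde (i j : 'I_m) (t : nat) : Omega -> R := g j t \+ c i j t.

Definition min_over (J : pred 'I_m) (x : 'I_m -> R) : \bar R :=
  \big[Order.min/+oo%E]_(j < m | J j) (x j)%:E.

(* Index shift: xi n is the mode xi_{n-1} of the mathematical notation, so that
   xi 0 is the initial mode and xi t.+1 the mode chosen at time t. The initial
   mode is required to be G_0-measurable. *)
Definition strategy (xi : nat -> Omega -> 'I_m) :=
  (forall B : set 'I_m, G 0%N (xi 0%N @^-1` B)) /\
  (forall t, (t <= T)%N -> forall B : set 'I_m, G t (xi t.+1 @^-1` B)).

Definition strategies_from (t : nat) (i : 'I_m) : set (nat -> Omega -> 'I_m) :=
  [set xi | strategy xi /\ \forall w \ae P, xi t w = i].

Definition switching_cost (xi : nat -> Omega -> 'I_m) (t : nat) : Omega -> R :=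
  fun w => gtilde (xi t w) (xi t.+1 w) t w.

Definition is_value_process (V : 'I_m -> nat -> Omega -> R) :=
  forall i t, (t <= T)%N ->
    is_ess_infimum
      [set agg_risk rho t T (switching_cost xi) | xi in strategies_from t i]
      (V i t).

(* Y^j_{t+1}, with the convention Y^j_{T+1} = 0 *)
Definition next_value (Y : 'I_m -> nat -> Omega -> R) (j : 'I_m) (t : nat) :
    Omega -> R :=
  if (t < T)%N then Y j t.+1 else cst 0.

(* min_{j != i} rho_t(gtilde_{i,j}(t) + Y^j_{t+1}), equal to +oo if m = 1 *)
Definition obstacle (Y : 'I_m -> nat -> Omega -> R) (i : 'I_m) (t : nat)
    (w : Omega) : \bar R :=
  min_over (predC1 i) (fun j => rho t (gtilde i j t \+ next_value Y j t) w).

(* The equations are stated in \bar R, where +-oo * 0 = 0. *)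
Record reflected_system (Y M A : 'I_m -> nat -> Omega -> R) : Prop :=
  ReflectedSystem {
  rs_eq : forall i t, (t <= T)%N -> \forall w \ae P,
    ((Y i t w)%:E =
       min_over predT (fun j => rho T (gtilde i j T) w)
       + (\sum_(t <= s < T) rho s (g i s \+ increment (M i) s) w
          - (M i T w - M i t w) - (A i T w - A i t w))%:E)%E ;
  rs_le : forall i t, (t <= T)%N -> \forall w \ae P,
    ((Y i t w)%:E <= obstacle Y i t w)%E ;
  rs_min : forall i, \forall w \ae P,
    (\sum_(0 <= t < T)
       ((Y i t w)%:E - obstacle Y i t w) * (increment (A i) t w)%:E = 0)%E }.

Record is_solution (Y M A : 'I_m -> nat -> Omega -> R) : Prop := IsSolution {
  sol_Y : forall i, bounded_adapted T G (Y i) ;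
  sol_M : forall i, bounded_adapted T G (M i) ;
  sol_A : forall i, bounded_adapted T G (A i) ;
  sol_mart : forall i, risk_martingale T rho (M i) ;
  sol_nondecr : forall i, nondecreasing_process T (A i) ;
  sol_pred : forall i, predictable T G (A i) ;
  sol_M0 : forall i, \forall w \ae P, M i 0%N w = 0 ;
  sol_A0 : forall i, \forall w \ae P, A i 0%N w = 0 ;
  sol_system : reflected_system Y M A }.

End switching.
End definitions.

(* Main.v *)
(* By translation invariance the reflected system decouples into one-step
   relations: for t < T,
     M_{t+1} - M_t = Y_{t+1} - rho_t(Y_{t+1}),
     A_{t+1} - A_t = rho_t(g(t) + Y_{t+1}) - Y_t,
   and the barrier and minimality conditions then say exactly that Y solves the
   Bellman equation Y^i_t = min_j rho_t(gtilde_ij(t) + Y^j_{t+1}), which is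
   solved by backward recursion. Conversely any Bellman solution is the value
   process, hence is unique: since rho_t is local on G_t-measurable events, Y
   bounds every aggregated cost from below, with equality for the strategy that
   picks a minimising mode at each step. *)

Require Import Defs.
From HB Require Import structures.
From mathcomp Require Import all_boot all_order all_algebra.
From mathcomp Require Import all_classical all_reals all_analysis measurable_realfun.
From mathcomp Require Import ring.

Set Implicit Arguments.
Unset Strict Implicit.
Unset Printing Implicit Defensive.

Import Order.TTheory GRing.Theory Num.Theory.
Local Open Scope classical_set_scope.
Local Open Scope ring_scope.

(** * Measurability of maps into finite types, with the discrete sigma-algebra *)

Definition fin_measurable {d} {T : measurableType d} {K : finType}
    (xi : T -> K) :=
  forall B : set K, measurable (xi @^-1` B).

Section fin_measurable.
Context {d : measure_display} {T : measurableType d}.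
Implicit Types K : finType.

Lemma fin_measurable_fiber K (xi : T -> K) :
  (forall k, measurable (xi @^-1` [set k])) -> fin_measurable xi.
Proof.
move=> mxi B.
have -> : xi @^-1` B = \bigcup_(k in B) (xi @^-1` [set k]).
  apply/seteqP; split => [w Bw|w [k Bk /= ->]//].
  by exists (xi w).
by apply: fin_bigcup_measurable => //; exact: finite_finset.
Qed.

Lemma fin_measurable_cst K (k : K) : fin_measurable (cst k : T -> K).
Proof. by move=> B; rewrite preimage_cst; case: ifP. Qed.

Lemma fin_measurable_comp K K' (xi : T -> K) (f : K -> K') :
  fin_measurable xi -> fin_measurable (f \o xi).
Proof. by move=> mxi B; rewrite comp_preimage; exact: mxi. Qed.

Lemma fin_measurable_pair K K' (xi : T -> K) (eta : T -> K') :
  fin_measurable xi -> fin_measurable eta ->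
  fin_measurable (fun w => (xi w, eta w)).
Proof.
move=> mxi meta; apply: fin_measurable_fiber => -[k l].
have -> : (fun w => (xi w, eta w)) @^-1` [set (k, l)] =
    xi @^-1` [set k] `&` eta @^-1` [set l].
  by apply/seteqP; split => w /=; case=> -> ->.
exact: measurableI.
Qed.

Lemma fin_measurable_finfun K K' (X : K -> T -> K') :
  (forall k, fin_measurable (X k)) ->
  fin_measurable (fun w => [ffun k => X k w]).
Proof.
move=> mX; apply: fin_measurable_fiber => s.
have -> : (fun w => [ffun k => X k w]) @^-1` [set s] =
    \bigcap_(k in [set: K]) (X k @^-1` [set s k]).
  apply/seteqP; split => [w <- k _|w Xs] /=; first by rewrite ffunE.
  by apply/ffunP => k; rewrite ffunE; exact: Xs.
by apply: fin_bigcap_measurable => [|k _]; [exact: finite_finset|exact: mX].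
Qed.

Lemma fin_measurable_ler {R : realType} (f g : T -> R) :
  measurable_fun setT f -> measurable_fun setT g ->
  fin_measurable (fun w => f w <= g w).
Proof.
move=> mf mg B; rewrite -[_ @^-1` _]setTI.
exact: (measurable_fun_ler mf mg).
Qed.

(** Splitting along the finitely many level sets of [xi] reduces a randomly selected map to the
    fixed maps [X k]; both gluing lemmas below rest on it. *)
Lemma glue_preimage K U (xi : T -> K) (X : K -> T -> U) (B : set U) :
  (fun w => X (xi w) w) @^-1` B =
  \bigcup_k (xi @^-1` [set k] `&` X k @^-1` B).
Proof.
apply/seteqP; split => [w XB|w [k _ [/= -> //]]].
by exists (xi w).
Qed.

Lemma fin_measurable_glue K K' (xi : T -> K) (X : K -> T -> K') :
  fin_measurable xi -> (forall k, fin_measurable (X k)) ->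
  fin_measurable (fun w => X (xi w) w).
Proof.
move=> mxi mX B; rewrite glue_preimage.
apply: fin_bigcup_measurable => [|k _]; first exact: finite_finset.
by apply: measurableI; [exact: mxi|exact: mX].
Qed.

Lemma measurable_fun_glue K d' (U : measurableType d') (xi : T -> K)
    (X : K -> T -> U) :
  fin_measurable xi -> (forall k, measurable_fun setT (X k)) ->
  measurable_fun setT (fun w => X (xi w) w).
Proof.
move=> mxi mX _ B mB; rewrite setTI glue_preimage.
apply: fin_bigcup_measurable => [|k _]; first exact: finite_finset.
by apply: measurableI; [exact: mxi|rewrite -[_ @^-1` _]setTI; exact: mX].
Qed.

End fin_measurable.

(** * Measurable choice of a minimising mode *)

Section minimizer.
Context {R : realType} {m : nat}.

(* The argument [i] is a default value, needed since ['I_m] may be empty. *)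
Definition minimizer (i : 'I_m) (f : 'I_m -> R) : 'I_m :=
  odflt i [pick k | [forall l, f k <= f l]].

Lemma minimizer_le i f j : f (minimizer i f) <= f j.
Proof.
rewrite /minimizer; case: pickP => [k /forallP//|] noarg.
case: (Order.TotalTheory.arg_minP f (erefl : xpredT i)) => k _ kmin.
by have /negbT/negP[] := noarg k; apply/forallP => l; exact: kmin.
Qed.

(** The choice depends on [w] only through the finite table of truth values [F k w <= F l w], so it
    is a function of a measurable finite-valued map. *)
Lemma minimizer_measurable d (T : measurableType d) i (F : 'I_m -> T -> R) :
  (forall j, measurable_fun setT (F j)) ->
  fin_measurable (fun w => minimizer i (F ^~ w)).
Proof.
move=> mF.
pose cmp (s : {ffun 'I_m * 'I_m -> bool}) : 'I_m :=
  odflt i [pick k | [forall l, s (k, l)]].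
have -> : (fun w => minimizer i (F ^~ w)) =
    cmp \o (fun w => [ffun p => F p.1 w <= F p.2 w]).
  apply/funext => w; rewrite /cmp /minimizer /=; congr odflt.
  by apply: eq_pick => k; apply: eq_forallb => l; rewrite ffunE.
apply: fin_measurable_comp; apply: fin_measurable_finfun => p.
exact: fin_measurable_ler.
Qed.

Lemma min_over_minimizer i (f : 'I_m -> R) :
  min_over predT f = (f (minimizer i f))%:E.
Proof.
apply/eqP; rewrite eq_le; apply/andP; split.
  exact: (bigmin_inf (minimizer i f)).
apply: le_bigmin => [|j _]; first exact: leey.
by rewrite lee_fin minimizer_le.
Qed.

(** Separates staying in mode [i] from switching away, the latter being the obstacle. *)
Lemma min_over_D1 i (f : 'I_m -> R) :
  min_over predT f = Order.min (f i)%:E (min_over (predC1 i) f).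
Proof. exact: bigminD1. Qed.

End minimizer.

(** * Essentially bounded random variables *)

Section bounded.
Context {R : realType} {d : measure_display} {Omega : measurableType d}.
Variable P : probability Omega R.
Implicit Types (X Y Z W : Omega -> R) (H : set_system Omega).

Lemma LinftyP X :
  Linfty P X <->
  measurable_fun setT X /\ exists C, \forall w \ae P, `|X w| <= C.
Proof.
have normP : finite_norm P +oo%E X <->
    (ess_sup_inf.ess_sup P (EFin \o (Num.norm \o X)) < +oo)%E.
  rewrite /finite_norm unlock; simpl.
  (* The norm of exponent [+oo] is the essential supremum when the space has positive mass, here
     mass 1. *)
  by rewrite probability_setT lte01.
rewrite /Linfty /= inE; split.
- move=> /andP[]; rewrite !inE /= => mX /normP /ess_sup_inf.ess_supr_bounded.
  by split.
- move=> [mX [C bX]]; apply/andP; split; rewrite inE //=; apply/normP.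
  apply: le_lt_trans (ltry C); apply/ess_sup_inf.ess_supP.
  by apply: filterS bX => w; rewrite /= lee_fin.
Qed.

Lemma Linfty_cst a : Linfty P (cst a).
Proof.
apply/LinftyP; split; first exact: measurable_cst.
by exists `|a|; exact: aeW.
Qed.

Lemma LinftyD X Y : Linfty P X -> Linfty P Y -> Linfty P (X \+ Y).
Proof.
move=> /LinftyP[mX [C bX]] /LinftyP[mY [D bY]]; apply/LinftyP; split.
  exact: measurable_funD.
exists (C + D); apply: filterS2 bX bY => w bX bY.
by rewrite (le_trans (ler_normD _ _))// lerD.
Qed.

Lemma LinftyB X Y : Linfty P X -> Linfty P Y -> Linfty P (X \- Y).
Proof.
move=> /LinftyP[mX [C bX]] /LinftyP[mY [D bY]]; apply/LinftyP; split.
  exact: measurable_funB.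
exists (C + D); apply: filterS2 bX bY => w bX bY.
by rewrite (le_trans (ler_normB _ _))// lerD.
Qed.

Lemma Linfty_glue (K : finType) (xi : Omega -> K) (X : K -> Omega -> R) :
  fin_measurable xi -> (forall k, Linfty P (X k)) ->
  Linfty P (fun w => X (xi w) w).
Proof.
move=> mxi LX; apply/LinftyP; split.
  by apply: measurable_fun_glue => // k; have /LinftyP[] := LX k.
have /choice[C bX] : forall k, exists C, \forall w \ae P, `|X k w| <= C.
  by move=> k; have /LinftyP[] := LX k.
exists (\sum_k `|C k|); apply: filterS (filter_forall _ bX) => w bXw.
rewrite (le_trans (bXw _))// (le_trans (ler_norm _))//.
by rewrite (bigD1 (xi w))//= lerDl sumr_ge0.
Qed.

Lemma Linfty_wrt_cst H a : Linfty_wrt P H (cst a).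
Proof. by split; [exact: Linfty_cst|exact: measurable_cst]. Qed.

Lemma Linfty_wrtD H X Y :
  Linfty_wrt P H X -> Linfty_wrt P H Y -> Linfty_wrt P H (X \+ Y).
Proof. by move=> [? ?] [? ?]; split; [exact: LinftyD|exact: measurable_funD]. Qed.

Lemma Linfty_wrtB H X Y :
  Linfty_wrt P H X -> Linfty_wrt P H Y -> Linfty_wrt P H (X \- Y).
Proof. by move=> [? ?] [? ?]; split; [exact: LinftyB|exact: measurable_funB]. Qed.

Lemma Linfty_wrt_sum H (X : nat -> Omega -> R) n :
  (forall s, (s < n)%N -> Linfty_wrt P H (X s)) ->
  Linfty_wrt P H (fun w => \sum_(s < n) X s w).
Proof.
elim: n => [|n IHn] LX.
  by under eq_fun do rewrite big_ord0; exact: Linfty_wrt_cst.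
under eq_fun do rewrite big_ord_recr /=.
apply: Linfty_wrtD; last exact: LX.
by apply: IHn => s sn; apply: LX; exact: ltnW.
Qed.

Lemma Linfty_wrtS H H' X : H `<=` H' -> Linfty_wrt P H X -> Linfty_wrt P H' X.
Proof.
move=> HH' [LX mX]; split=> // _ B mB.
exact: (@sub_sigma_algebra2 _ setT H' H HH' _ (mX measurableT B mB)).
Qed.

Lemma ae_forall_lt T (Q : nat -> Omega -> Prop) :
  (forall t, (t < T)%N -> \forall w \ae P, Q t w) ->
  \forall w \ae P, forall t, (t < T)%N -> Q t w.
Proof.
move=> QT; apply: ae_foralln => t.
by have [tT|tT] := boolP (t < T)%N; [apply: filterS (QT t tT)|apply: aeW].
Qed.

End bounded.

(** * Locality of risk mappings, aggregated risk and martingales *)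

Section risk_mapping.
Context {R : realType} {d : measure_display} {Omega : measurableType d}.
Context (P : probability Omega R) (T : nat) (G : nat -> set_system Omega).
Context (rho : nat -> (Omega -> R) -> Omega -> R).
Context (hG : filtration T G) (hrho : cond_risk_mapping P T G rho).
Implicit Types (X Y Z W : Omega -> R).

Lemma measurable_filtration t : (t <= T)%N -> (G t).-sigma.-measurable = G t.
Proof. by move=> tT; apply: measurable_g_measurableTypeE; have [] := hG.1 t tT. Qed.

Lemma fin_measurable_sub t (K : finType) (xi : Omega -> K) : (t <= T)%N ->
  @fin_measurable _ (g_sigma_algebraType (G t)) K xi -> fin_measurable xi.
Proof.
move=> tT mxi B; have [_] := hG.1 t tT; apply.
by rewrite -measurable_filtration//; exact: mxi.
Qed.

Lemma Linfty_wrt_glue t (K : finType) (xi : Omega -> K) (X : K -> Omega -> R) :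
  (t <= T)%N -> @fin_measurable _ (g_sigma_algebraType (G t)) K xi ->
  (forall k, Linfty_wrt P (G t) (X k)) ->
  Linfty_wrt P (G t) (fun w => X (xi w) w).
Proof.
move=> tT mxi LX; split.
  by apply: Linfty_glue => [|k]; [exact: fin_measurable_sub mxi|have [] := LX k].
by apply: (@measurable_fun_glue _ (g_sigma_algebraType (G t))) => // k;
  have [] := LX k.
Qed.

Lemma rho_Linfty_wrt t W : (t <= T)%N -> Linfty P W ->
  Linfty_wrt P (G t) (rho t W).
Proof. exact: crm_codom. Qed.

Lemma rho_Linfty t W : (t <= T)%N -> Linfty P W -> Linfty P (rho t W).
Proof. by move=> tT LW; have [] := rho_Linfty_wrt tT LW. Qed.

(* A large constant added off B makes the inequality global, and it is
   G_t-measurable, hence translation invariance takes it out of rho_t. *)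
Lemma rho_le_on t (B : set Omega) W Z : (t <= T)%N -> G t B ->
  Linfty P W -> Linfty P Z -> (\forall w \ae P, B w -> W w <= Z w) ->
  \forall w \ae P, B w -> rho t W w <= rho t Z w.
Proof.
move=> tT GB LW LZ WZ.
have /LinftyP[_ [C bWZ]] := LinftyB LW LZ.
pose U := fun w => (if w \in B then cst 0 else cst C : Omega -> R) w.
have LU : Linfty_wrt P (G t) U.
  have mB : @fin_measurable _ (g_sigma_algebraType (G t)) _ (fun w => w \in B).
    apply: fin_measurable_fiber => -[].
    - have -> : (fun w => w \in B) @^-1` [set true] = B.
        by apply/seteqP; split => w /=; [move/set_mem|move/mem_set].
      by rewrite measurable_filtration.
    - have -> : (fun w => w \in B) @^-1` [set false] = ~` B.
        apply/seteqP; split => w /=; first by move/negbT; rewrite notin_setE.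
        by move=> Bw; apply/negbTE; rewrite notin_setE.
      by apply: measurableC; rewrite measurable_filtration.
  apply: (@Linfty_wrt_glue t _ (fun w => w \in B)
            (fun b => if b then cst 0 else cst C)) => //.
  by case; exact: Linfty_wrt_cst.
have WUZ : \forall w \ae P, W w <= (U \+ Z) w.
  apply: filterS2 WZ bWZ => w WZ bWZ; rewrite /U /=.
  case: ifPn => [|_]; first by rewrite inE add0r.
  by rewrite -lerBlDr (le_trans (ler_norm _)).
apply: filterS2 (crm_trans hrho tT LU LZ)
  (crm_mono hrho tT LW (LinftyD LU.1 LZ) WUZ) => w -> + Bw.
by rewrite /U mem_set// add0r.
Qed.

Lemma rho_eq_on t (B : set Omega) W Z : (t <= T)%N -> G t B ->
  Linfty P W -> Linfty P Z -> (\forall w \ae P, B w -> W w = Z w) ->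
  \forall w \ae P, B w -> rho t W w = rho t Z w.
Proof.
move=> tT GB LW LZ WZ.
have le1 : \forall w \ae P, B w -> W w <= Z w.
  by apply: filterS WZ => w WZ Bw; rewrite WZ.
have le2 : \forall w \ae P, B w -> Z w <= W w.
  by apply: filterS WZ => w WZ Bw; rewrite WZ.
apply: filterS2 (rho_le_on tT GB LW LZ le1) (rho_le_on tT GB LZ LW le2).
by move=> w le12 le21 Bw; apply/eqP; rewrite eq_le le12 ?le21.
Qed.

Lemma eq_rho t W Z : (t <= T)%N -> Linfty P W -> Linfty P Z ->
  (\forall w \ae P, W w = Z w) -> \forall w \ae P, rho t W w = rho t Z w.
Proof.
move=> tT LW LZ WZ.
have GT : G t setT by rewrite -(measurable_filtration tT); exact: measurableT.
have WZT : \forall w \ae P, [set: Omega] w -> W w = Z w.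
  by apply: filterS WZ.
by apply: filterS (rho_eq_on tT GT LW LZ WZT) => w; exact.
Qed.

Lemma rho_id t Z : (t <= T)%N -> Linfty_wrt P (G t) Z ->
  \forall w \ae P, rho t Z w = Z w.
Proof.
move=> tT LZ.
apply: filterS3 (crm_trans hrho tT LZ (Linfty_cst P 0)) (crm_norm hrho tT)
  (eq_rho tT LZ.1 (LinftyD LZ.1 (Linfty_cst P 0)) _) => [w -> -> ->|].
- by rewrite addr0.
- by apply: aeW => w /=; rewrite addr0.
Qed.

(** Locality on each of the finitely many level sets of [xi], which are events of [G t] on which the
    glued function agrees with [X k]. It lets random modes be frozen inside [rho t]. *)
Lemma rho_glue t (K : finType) (xi : Omega -> K) (X : K -> Omega -> R) :
  (t <= T)%N -> @fin_measurable _ (g_sigma_algebraType (G t)) K xi ->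
  (forall k, Linfty P (X k)) ->
  \forall w \ae P, rho t (fun w => X (xi w) w) w = rho t (X (xi w)) w.
Proof.
move=> tT mxi LX.
have Xk k : \forall w \ae P, (xi @^-1` [set k]) w ->
    rho t (fun w => X (xi w) w) w = rho t (X k) w.
  apply: rho_eq_on => //.
  - by rewrite -(measurable_filtration tT); exact: mxi.
  - by apply: Linfty_glue LX; exact: fin_measurable_sub mxi.
  - by apply: aeW => w /= ->.
by apply: filterS (filter_forall _ Xk) => w /(_ (xi w)); exact.
Qed.

Lemma agg_risk_last s (W : nat -> Omega -> R) : agg_risk rho s s W = rho s (W s).
Proof. by rewrite /agg_risk subnn. Qed.

Lemma agg_riskS s t (W : nat -> Omega -> R) : (s < t)%N ->
  agg_risk rho s t W = rho s (W s \+ agg_risk rho s.+1 t W).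
Proof. by move=> st; rewrite /agg_risk -(subnSK st). Qed.

Lemma agg_risk_Linfty s t (W : nat -> Omega -> R) : (s <= t <= T)%N ->
  (forall u, (u <= T)%N -> Linfty P (W u)) -> Linfty P (agg_risk rho s t W).
Proof.
move=> /andP[st tT] LW; rewrite -(subnKC st) in tT *.
move: (t - s)%N tT {st} => n; elim: n s => [|n IHn] s sT.
  by rewrite addn0 in sT *; rewrite agg_risk_last; apply: rho_Linfty => //; exact: LW.
have sT' : (s <= T)%N by apply: leq_trans sT; exact: leq_addr.
rewrite agg_riskS ?addnS ?ltnS ?leq_addr//; apply: rho_Linfty => //.
apply: LinftyD; first exact: LW.
by rewrite -addSn; apply: IHn; rewrite addSnnS.
Qed.

(** With zero intermediate costs the aggregated risk is a composition of one-step maps whose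
    innermost factor [rho t] fixes [M t]; the one-step identities collapse it by induction on
    [t - s]. *)
Lemma risk_martingaleP (M : nat -> Omega -> R) : bounded_adapted P T G M ->
  risk_martingale P T rho M <->
  forall t, (t < T)%N -> \forall w \ae P, M t w = rho t (M t.+1) w.
Proof.
move=> LM; split=> [martM t tT|stepM s t /andP[st tT]].
- have := martM t t.+1; rewrite leqnSn tT => /(_ isT).
  rewrite agg_riskS// agg_risk_last eqxx ltn_eqF//.
  have LMt : Linfty P (M t.+1) by have [] := LM _ tT.
  have add0M : \forall w \ae P,
      (cst 0 \+ rho t.+1 (M t.+1)) w = M t.+1 w.
    by apply: filterS (rho_id tT (LM _ tT)) => w /= ->; rewrite add0r.
  have LM0 : Linfty P (cst 0 \+ rho t.+1 (M t.+1)).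
    by apply: LinftyD; [exact: Linfty_cst|exact: rho_Linfty].
  by apply: filterS2 (eq_rho (ltnW tT) LM0 LMt add0M) => w /= -> ->.
- rewrite -(subnKC st) in tT *.
  move: (t - s)%N tT {st} => n; elim: n s => [|n IHn] s sT.
    rewrite addn0 in sT *; rewrite agg_risk_last eqxx.
    by apply: filterS (rho_id sT (LM _ sT)) => w ->.
  have lt_st : (s < s + n.+1)%N by rewrite addnS ltnS leq_addr.
  have sT' : (s < T)%N by exact: leq_trans sT.
  rewrite agg_riskS// ltn_eqF//.
  have LMs : Linfty P (M s.+1) by have [] := LM _ sT'.
  rewrite -addSnnS in sT *.
  have LWt u : (u <= T)%N ->
      Linfty P (if u == (s.+1 + n)%N then M (s.+1 + n)%N else cst 0).
    by move=> uT; case: ifP => _; [have [] := LM _ sT|exact: Linfty_cst].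
  have LN : Linfty P (agg_risk rho s.+1 (s.+1 + n)
      (fun u => if u == (s.+1 + n)%N then M (s.+1 + n)%N else cst 0)).
    by apply: agg_risk_Linfty => //; rewrite leq_addr.
  apply: filterS2 (stepM _ sT') (eq_rho (ltnW sT') LMs
    (LinftyD (Linfty_cst P 0) LN) _) => [w -> ->//|].
  by apply: filterS (IHn _ sT) => w -> /=; rewrite add0r.
Qed.

End risk_mapping.

(** * The Bellman equation and its identification with the value process *)

Section switching.
Context {R : realType} {d : measure_display} {Omega : measurableType d}.
Context (P : probability Omega R) (T m : nat) (G : nat -> set_system Omega).
Context (rho : nat -> (Omega -> R) -> Omega -> R).
Context (g : 'I_m -> nat -> Omega -> R) (c : 'I_m -> 'I_m -> nat -> Omega -> R).
Context (hG : filtration T G) (hrho : cond_risk_mapping P T G rho).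
Context (hg : forall i t, (t <= T)%N -> Linfty P (g i t)).
Context (hc : forall i j t, (t <= T)%N -> Linfty P (c i j t)).
Context (hc0 : forall i t, (t <= T)%N -> \forall w \ae P, c i i t w = 0).
Implicit Types (Y M A : 'I_m -> nat -> Omega -> R) (i j : 'I_m).
Implicit Types (xi : nat -> Omega -> 'I_m).

Definition continuation Y i j t : Omega -> R :=
  rho t (gtilde g c i j t \+ next_value T Y j t).

(** Since [next_value] vanishes at [T], the case [t = T] is the terminal condition. *)
Definition bellman Y := forall i t, (t <= T)%N ->
  \forall w \ae P,
    (Y i t w)%:E = min_over predT (fun j => continuation Y i j t w).

Lemma gtilde_Linfty i j t : (t <= T)%N -> Linfty P (gtilde g c i j t).
Proof. by move=> tT; apply: LinftyD; [exact: hg|exact: hc]. Qed.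

(** The step receives [Q t.+1] only when [t < T], so it covers the terminal time as well, matching
    the case split in [next_value]. *)
Lemma backward_ind (Q : nat -> Prop) :
  (forall t, (t <= T)%N -> ((t < T)%N -> Q t.+1) -> Q t) ->
  forall t, (t <= T)%N -> Q t.
Proof.
move=> step t tT; move: tT (subnKC tT); move: (T - t)%N => n.
elim: n t => [|n IHn] t tT tnT; apply: step => // tT'.
  by move: tT'; rewrite -tnT addn0 ltnn.
by apply: IHn => //; rewrite addSnnS.
Qed.

Section adapted.
Context (Y : 'I_m -> nat -> Omega -> R).
Context (LY : forall i, bounded_adapted P T G (Y i)).

Lemma next_value_Linfty j t : Linfty P (next_value T Y j t).
Proof.
rewrite /next_value; case: ifPn => tT; last exact: Linfty_cst.
by have [] := LY j tT.
Qed.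

Lemma continuation_Linfty_wrt i j t : (t <= T)%N ->
  Linfty_wrt P (G t) (continuation Y i j t).
Proof.
move=> tT; apply: (rho_Linfty_wrt hrho) => //.
by apply: LinftyD; [exact: gtilde_Linfty|exact: next_value_Linfty].
Qed.

(** As [c i i] vanishes, staying in mode [i] costs only [g i]; this is the quantity that the
    increments of [A] compare with [Y]. *)
Lemma continuation_diag i t : (t < T)%N ->
  \forall w \ae P, continuation Y i i t w = rho t (g i t \+ Y i t.+1) w.
Proof.
move=> tT; have tT' := ltnW tT; apply: (eq_rho hG hrho) => //.
- by apply: LinftyD; [exact: gtilde_Linfty|exact: next_value_Linfty].
- by apply: LinftyD; [exact: hg|have [] := LY i tT].
- by apply: filterS (hc0 i tT') => w; rewrite /gtilde /next_value tT /= => ->;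
    rewrite addr0.
Qed.

Lemma strategy_fin_measurable xi t : (t <= T)%N -> strategy T G xi ->
  @fin_measurable _ (g_sigma_algebraType (G t)) _ (xi t) /\
  @fin_measurable _ (g_sigma_algebraType (G t)) _ (xi t.+1).
Proof.
move=> tT [xi0 xiS]; split=> B; rewrite (measurable_filtration hG)//; last exact: xiS.
(* By the index shift [xi t] is the mode chosen one step earlier, so for positive times its
   measurability comes from the preceding sigma-algebra. *)
case: t tT => [//|t] tT; apply: (hG.2 t t.+1); first by rewrite leqnSn.
by apply: xiS; exact: ltnW.
Qed.

Lemma switching_cost_Linfty xi t : (t <= T)%N -> strategy T G xi ->
  Linfty P (switching_cost g c xi t).
Proof.
move=> tT /(strategy_fin_measurable tT)[mx mxS].
apply: (@Linfty_glue _ _ _ _ _ (fun w => (xi t w, xi t.+1 w))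
          (fun p => gtilde g c p.1 p.2 t)).
- apply: (fin_measurable_sub hG tT); exact: fin_measurable_pair.
- by move=> p; exact: gtilde_Linfty.
Qed.

(** [rho_glue] applied to the pair of modes before and after the decision, both known at time
    [t]. *)
Lemma continuation_strategy xi t : (t <= T)%N -> strategy T G xi ->
  Linfty P (fun w => next_value T Y (xi t.+1 w) t w) /\
  \forall w \ae P,
    rho t (switching_cost g c xi t \+
             (fun w => next_value T Y (xi t.+1 w) t w)) w =
    continuation Y (xi t w) (xi t.+1 w) t w.
Proof.
move=> tT /(strategy_fin_measurable tT)[mx mxS]; split.
  apply: (@Linfty_glue _ _ _ _ _ (xi t.+1) (fun j => next_value T Y j t)) => [|j];
    last exact: next_value_Linfty.
  exact: (fin_measurable_sub hG tT).
apply: (@rho_glue _ _ _ _ _ _ _ hG hrho _ _ (fun w => (xi t w, xi t.+1 w))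
          (fun p => gtilde g c p.1 p.2 t \+ next_value T Y p.2 t)) => //.
- exact: fin_measurable_pair.
- by move=> p; apply: LinftyD; [exact: gtilde_Linfty|exact: next_value_Linfty].
Qed.

(** Counterpart of [next_value] for aggregated risk; the zero beyond the horizon lets one recursion
    hold for all [t <= T]. *)
Definition next_risk (W : nat -> Omega -> R) t : Omega -> R :=
  if (t < T)%N then agg_risk rho t.+1 T W else cst 0.

Lemma agg_risk_next t (W : nat -> Omega -> R) : (t <= T)%N ->
  agg_risk rho t T W = rho t (W t \+ next_risk W t).
Proof.
rewrite leq_eqVlt /next_risk => /predU1P[->|tT].
  rewrite ltnn agg_risk_last; congr rho.
  by apply/funext => w /=; rewrite addr0.
by rewrite tT agg_riskS.
Qed.

Lemma next_risk_Linfty t (W : nat -> Omega -> R) :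
  (forall u, (u <= T)%N -> Linfty P (W u)) -> Linfty P (next_risk W t).
Proof.
move=> LW; rewrite /next_risk; case: ifPn => tT; last exact: Linfty_cst.
by apply: (agg_risk_Linfty hrho) => //; rewrite tT /=.
Qed.

Context (bY : bellman Y).

Lemma bellman_le i j t : (t <= T)%N ->
  \forall w \ae P, Y i t w <= continuation Y i j t w.
Proof.
move=> tT; apply: filterS (bY i tT) => w Yw; rewrite -lee_fin Yw.
exact: (bigmin_inf j).
Qed.

(** Backward induction: by monotonicity the future risk may be replaced by [Y] at the next mode,
    [continuation_strategy] evaluates the result with the modes frozen, and the Bellman minimum lies
    below it. *)
Lemma bellman_le_agg_risk xi t : (t <= T)%N -> strategy T G xi ->
  \forall w \ae P,
    Y (xi t w) t w <= agg_risk rho t T (switching_cost g c xi) w.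
Proof.
move=> + sxi; move: t; apply: backward_ind => t tT IH; rewrite agg_risk_next//.
have Lcost u : (u <= T)%N -> Linfty P (switching_cost g c xi u).
  by move=> uT; exact: switching_cost_Linfty.
have [LN eqN] := continuation_strategy tT sxi.
have LR := next_risk_Linfty t Lcost.
have leN : \forall w \ae P,
    (switching_cost g c xi t \+ (fun w => next_value T Y (xi t.+1 w) t w)) w <=
    (switching_cost g c xi t \+ next_risk (switching_cost g c xi) t) w.
  rewrite /next_risk /next_value; move: IH; case: ifPn => // _; last first.
    by move=> _; apply: aeW.
  by move=> /(_ isT); apply: filterS => w; rewrite /= lerD2l.
(* The modes depend on [w], so the bound must hold for all pairs of modes outside a single null
   set. *)
have leY : \forall w \ae P, forall i j, Y i t w <= continuation Y i j t w.
  by apply: filter_forall => i; apply: filter_forall => j; exact: bellman_le.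
apply: filterS3 eqN leY
  (crm_mono hrho tT (LinftyD (Lcost _ tT) LN) (LinftyD (Lcost _ tT) LR) leN).
by move=> w -> leY; apply: le_trans; exact: leY.
Qed.

(* Index shift as in [strategy]: [greedy t0 i n.+1] is the mode chosen at time n,
   which is frozen to [i] before [t0] and optimal from [t0] on. *)
Fixpoint greedy (t0 : nat) i n : Omega -> 'I_m :=
  if n is k.+1 then
    if (k < t0)%N then cst i
    else fun w =>
      minimizer (greedy t0 i k w) (fun j => continuation Y (greedy t0 i k w) j k w)
  else cst i.

Lemma greedy_start t0 i : greedy t0 i t0 = cst i.
Proof. by case: t0 => [//|t0] /=; rewrite ltnSn. Qed.

Lemma greedy_strategy t0 i : strategy T G (greedy t0 i).
Proof.
have greedyS t : (t <= T)%N ->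
    @fin_measurable _ (g_sigma_algebraType (G t)) _ (greedy t0 i t) ->
    @fin_measurable _ (g_sigma_algebraType (G t)) _ (greedy t0 i t.+1).
  move=> tT mt /=; case: ifP => _; first exact: fin_measurable_cst.
  (* For a fixed previous mode [k] the minimiser is [G t]-measurable; gluing along the previous mode
     gives the next one. *)
  apply: (@fin_measurable_glue _ (g_sigma_algebraType (G t)) _ _ (greedy t0 i t)
    (fun k w => minimizer k (fun j => continuation Y k j t w))) => // k.
  by apply: minimizer_measurable => j; have [] := continuation_Linfty_wrt k j tT.
have mgreedy t : (t <= T)%N ->
    @fin_measurable _ (g_sigma_algebraType (G t)) _ (greedy t0 i t).
  elim: t => [|t IHt] tT; first exact: fin_measurable_cst.
  move=> B; rewrite (measurable_filtration hG)//.
  apply: (hG.2 t t.+1); first by rewrite leqnSn.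
  rewrite -(measurable_filtration hG (ltnW tT)).
  by apply: greedyS; [exact: ltnW|apply: IHt; exact: ltnW].
split=> [B|t tT B].
  by rewrite -(measurable_filtration hG (leq0n T)); exact: mgreedy.
by rewrite -(measurable_filtration hG tT); apply: greedyS => //; exact: mgreedy.
Qed.

(** The induction of [bellman_le_agg_risk] with equalities throughout, since from [t0] on each
    chosen mode attains the Bellman minimum. *)
Lemma greedy_agg_risk t0 i t : (t <= T)%N -> (t0 <= t)%N ->
  \forall w \ae P,
    agg_risk rho t T (switching_cost g c (greedy t0 i)) w =
    Y (greedy t0 i t w) t w.
Proof.
set xi := greedy t0 i; have sxi : strategy T G xi by exact: greedy_strategy.
move: t; apply: backward_ind => t tT IH t0t; rewrite agg_risk_next//.
have Lcost u : (u <= T)%N -> Linfty P (switching_cost g c xi u).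
  by move=> uT; exact: switching_cost_Linfty.
have [LN eqN] := continuation_strategy tT sxi.
have LR := next_risk_Linfty t Lcost.
have eqNR : \forall w \ae P,
    (switching_cost g c xi t \+ next_risk (switching_cost g c xi) t) w =
    (switching_cost g c xi t \+ (fun w => next_value T Y (xi t.+1 w) t w)) w.
  rewrite /next_risk /next_value; move: IH; case: ifPn => // _; last first.
    by move=> _; apply: aeW.
  by move=> /(_ isT (leqW t0t)); apply: filterS => w /= ->.
have Ymin : \forall w \ae P, forall j,
    (Y j t w)%:E = min_over predT (fun k => continuation Y j k t w).
  by apply: filter_forall => j; exact: bY.
apply: filterS3 eqN Ymin (eq_rho hG hrho tT (LinftyD (Lcost _ tT) LR)
  (LinftyD (Lcost _ tT) LN) eqNR) => w eqN Ymin ->.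
(* The current mode is the default value, as in [greedy], so this minimiser is literally the next
   mode [xi t.+1 w]. *)
rewrite eqN; apply: EFin_inj; rewrite Ymin (min_over_minimizer (xi t w)).
by rewrite /xi /= ltnNge t0t.
Qed.

(** The infimum is attained: a lower bound [Z] of the family need only be compared with the greedy
    strategy started at [t] in mode [i]. *)
Lemma bellman_value_process : is_value_process P T G rho g c Y.
Proof.
move=> i t tT; split.
- by have [/LinftyP[]] := LY i tT.
- move=> _ [xi [sxi xit] <-].
  by apply: filterS2 xit (bellman_le_agg_risk tT sxi) => w ->.
- move=> Z mZ /(_ (agg_risk rho t T (switching_cost g c (greedy t i)))) leZ.
  apply: filterS2 (greedy_agg_risk i tT (leqnn t)) (leZ _) => [w ->|].
    by rewrite greedy_start.
  exists (greedy t i) => //; split; first exact: greedy_strategy.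
  by rewrite greedy_start; apply: aeW.
Qed.

End adapted.

(** Both are essential infima of the same family of aggregated costs, hence each lies below the
    other. *)
Lemma bellman_unique Y Y' :
  (forall i, bounded_adapted P T G (Y i)) -> bellman Y ->
  (forall i, bounded_adapted P T G (Y' i)) -> bellman Y' ->
  forall i t, (t <= T)%N -> \forall w \ae P, Y i t w = Y' i t w.
Proof.
move=> LY bY LY' bY' i t tT.
have [mY lbY glbY] := bellman_value_process LY bY i tT.
have [mY' lbY' glbY'] := bellman_value_process LY' bY' i tT.
apply: filterS2 (glbY (EFin \o Y' i t) _ _) (glbY' (EFin \o Y i t) _ _).
- by move=> w /= leY'Y leYY'; apply/eqP; rewrite -eqe eq_le leYY'.
- exact/measurable_EFinP.
- by move=> W /lbY'; apply: filterS => w; rewrite lee_fin.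
- exact/measurable_EFinP.
- by move=> W /lbY; apply: filterS => w; rewrite lee_fin.
Qed.

(** * From a solution of the system to the Bellman equation *)

(** Subtracting the equations at [t] and [t.+1] writes [Y i t.+1] as [Z] plus the increment of [M],
    with [Z] measurable for [G t]. As [rho t] annihilates that increment, it sends [Y i t.+1] to
    [Z], which identifies the increment of [M]; adding [g i t] before applying [rho t] identifies
    that of [A]. *)
Lemma solution_increments Y M A : is_solution P T G rho g c Y M A ->
  forall i t, (t < T)%N -> \forall w \ae P,
    increment (M i) t w = Y i t.+1 w - rho t (Y i t.+1) w /\
    increment (A i) t w = rho t (g i t \+ Y i t.+1) w - Y i t w.
Proof.
move=> [LY LM LA martM _ predA _ _ [eqY _ _]] i t tT; have tT' := ltnW tT.
have GS : G t `<=` G t.+1 by apply: hG.2; rewrite leqnSn.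
have [LYt LYS] := (LY i t tT', (LY i _ tT).1).
have [LMt LMS] := (LM i t tT', (LM i _ tT).1).
have LdM : Linfty P (increment (M i) t) by apply: LinftyB; [|exact: LMt.1].
have LgdM := LinftyD (hg i tT') LdM.
(* Predictability makes this increment [G t]-measurable, so that it can leave [rho t]. *)
have LdA : Linfty_wrt P (G t) (increment (A i) t).
  apply: Linfty_wrtB; last exact: LA.
  by split; [exact: (LA i _ tT).1|exact: (predA i).2].
pose Z := (Y i t \- rho t (g i t \+ increment (M i) t)) \+ increment (A i) t.
have LZ : Linfty_wrt P (G t) Z.
  by apply: Linfty_wrtD => //; apply: Linfty_wrtB => //; exact: (rho_Linfty_wrt hrho).
have YZ : \forall w \ae P, Y i t.+1 w = Z w + increment (M i) t w.
  apply: filterS2 (eqY i t tT') (eqY i t.+1 tT) => w.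
  (* The left-hand sides are real, so an infinite terminal minimum is contradictory. *)
  case: (min_over _ _) => [x| |] //=; rewrite -!EFinD => -[Yt] [YS].
  have dMw : increment (M i) t w = M i t.+1 w - M i t w by [].
  have dAw : increment (A i) t w = A i t.+1 w - A i t w by [].
  by rewrite /Z /= dMw dAw Yt YS (big_ltn tT) /=; ring.
have rho_dM : \forall w \ae P, rho t (increment (M i) t) w = 0.
  have LNM : Linfty_wrt P (G t) (cst 0 \- M i t).
    by apply: Linfty_wrtB => //; exact: Linfty_wrt_cst.
  have -> : increment (M i) t = (cst 0 \- M i t) \+ M i t.+1.
    by apply/funext => w; rewrite /increment /=; ring.
  apply: filterS2 (crm_trans hrho tT' LNM LMS)
    ((risk_martingaleP hG hrho (LM i)).1 (martM i) t tT) => w -> /= ->.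
  by ring.
have rhoY : \forall w \ae P, rho t (Y i t.+1) w = Z w.
  apply: filterS3 (eq_rho hG hrho tT' LYS (LinftyD LZ.1 LdM) YZ)
    (crm_trans hrho tT' LZ LdM) rho_dM => w -> -> ->.
  by rewrite addr0.
have YgZ : \forall w \ae P,
    (g i t \+ Y i t.+1) w = (Z \+ (g i t \+ increment (M i) t)) w.
  by apply: filterS YZ => w /= ->; ring.
have rhogY : \forall w \ae P,
    rho t (g i t \+ Y i t.+1) w = Y i t w + increment (A i) t w.
  apply: filterS2 (eq_rho hG hrho tT' (LinftyD (hg i tT') LYS)
    (LinftyD LZ.1 LgdM) YgZ) (crm_trans hrho tT' LZ LgdM) => w -> ->.
  by rewrite /Z /=; ring.
by apply: filterS3 YZ rhoY rhogY => w -> -> ->; split; ring.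
Qed.

(** Used with [y] the value, [a] the increment of [A] and [S] the obstacle, so that [y + a] is the
    cost of staying. If [a = 0] then [y] is already below [S]; otherwise the slack vanishes and
    [S = y]. *)
Lemma minE_complementary (y a : R) (S : \bar R) : 0 <= a -> (y%:E <= S)%E ->
  ((y%:E - S) * a%:E = 0)%E -> y%:E = Order.min (y + a)%:E S.
Proof.
move=> a0 yS slack; have [a_eq0|a_neq0] := eqVneq a 0.
  by rewrite a_eq0 addr0 min_l.
case: S yS slack => [s| |]//.
- rewrite lee_fin -EFinB -EFinM => ys [/eqP].
  rewrite mulf_eq0 (negbTE a_neq0) orbF subr_eq0 => /eqP ->.
  by rewrite min_r// lee_fin lerDl.
(* An infinite obstacle, as for [m = 1], makes the product infinite when [a] is nonzero. *)
- move=> _; rewrite addeNy => /eqP.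
  by rewrite mule_eq0 //= eqe (negbTE a_neq0).
Qed.

(** The other terms are nonpositive, so the sum is at most [F t]. This splits the minimality
    condition into one condition for each time. *)
Lemma sume_le0_eq0 (F : nat -> \bar R) :
  (forall t, (t < T)%N -> (F t <= 0)%E) ->
  (\sum_(0 <= t < T) F t = 0)%E -> forall t, (t < T)%N -> F t = 0%E.
Proof.
move=> F0 sum0 t tT; apply/eqP; rewrite eq_le F0//= -sum0.
rewrite (bigD1_seq t) ?mem_index_iota ?iota_uniq//= geeDl//.
rewrite big_seq_cond sume_le0// => s /andP[+ _].
by rewrite mem_index_iota => /andP[_]; exact: F0.
Qed.

(** Each term of the minimality sum is a nonpositive slack times a nonnegative increment, so all
    vanish and [minE_complementary] applies at each [t < T]; at [T] the equation itself is the
    claim. *)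
Lemma solution_bellman Y M A : is_solution P T G rho g c Y M A -> bellman Y.
Proof.
move=> solY i t; have [LY _ _ _ ndA _ _ _ [eqY leY minY]] := solY.
rewrite leq_eqVlt => /predU1P[->|tT].
  apply: filterS (eqY i T (leqnn T)) => w ->.
  rewrite big_geq// !subrr adde0.
  apply: eq_bigr => j _; congr EFin; rewrite /continuation /next_value ltnn.
  by congr (rho T _ w); apply/funext => v /=; rewrite addr0.
have tT' := ltnW tT.
have leYT : \forall w \ae P, forall s, (s < T)%N ->
    ((Y i s w)%:E <= obstacle T rho g c Y i s w)%E.
  by apply: ae_forall_lt => s sT; exact: leY (ltnW sT).
have ndAT : \forall w \ae P, forall s, (s < T)%N -> A i s w <= A i s.+1 w.
  by apply: ae_forall_lt => s sT; exact: ndA.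
have slack : \forall w \ae P, (((Y i t w)%:E - obstacle T rho g c Y i t w) *
    (increment (A i) t w)%:E = 0)%E.
  apply: filterS3 leYT ndAT (minY i) => w leYw ndAw.
  move/sume_le0_eq0; apply => // s sT; apply: mule_le0_ge0.
    by rewrite sube_le0 leYw.
  by rewrite lee_fin subr_ge0 ndAw.
apply: filterS3 (filterI leYT ndAT) slack
  (filterI (continuation_diag LY i tT) (solution_increments solY i tT)).
move=> w [leYw ndAw] slackw [diagw [_ dAw]].
rewrite (min_over_D1 i) diagw.
have -> : rho t (g i t \+ Y i t.+1) w = Y i t w + increment (A i) t w.
  by rewrite dAw; ring.
apply: minE_complementary => //; last exact: leYw.
by rewrite subr_ge0 ndAw.
Qed.

(** * Backward construction of a Bellman solution *)

(** The recursion is on the number [n] of remaining steps. The minimum is written as the value at a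
    minimiser so that it stays real. *)
Fixpoint value_to_go n i (w : Omega) : R :=
  let F j := rho (T - n) (gtilde g c i j (T - n) \+
    (if n is k.+1 then value_to_go k j else cst 0)) w in
  F (minimizer i F).

Definition value i t : Omega -> R := value_to_go (T - t) i.

Lemma valueE i t : (t <= T)%N ->
  value i t = fun w =>
    continuation value i (minimizer i (fun j => continuation value i j t w)) t w.
Proof.
rewrite leq_eqVlt /continuation /next_value /value => /predU1P[->|tT].
  by rewrite subnn ltnn /= subn0.
by rewrite tT -(subnSK tT) /= subnSK// subKn// ltnW.
Qed.

Lemma value_adapted i : bounded_adapted P T G (value i).
Proof.
move=> t tT; move: t tT i; apply: backward_ind => t tT IH i.
have Lcont j : Linfty_wrt P (G t) (continuation value i j t).
  apply: (rho_Linfty_wrt hrho) => //; apply: LinftyD; first exact: gtilde_Linfty.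
  rewrite /next_value; case: ifPn => tT'; last exact: Linfty_cst.
  by have [] := IH tT' j.
rewrite valueE//.
apply: (Linfty_wrt_glue hG tT
  (xi := fun w => minimizer i (fun j => continuation value i j t w))
  (X := fun j => continuation value i j t)) => //.
by apply: minimizer_measurable => j; have [] := Lcont j.
Qed.

Lemma value_bellman : bellman value.
Proof.
by move=> i t tT; apply: aeW => w; rewrite (min_over_minimizer i) valueE.
Qed.

(** * From the Bellman equation to a solution of the system *)

(** The martingale of a Doob decomposition, with [rho s] in place of conditional expectation. *)
Definition martingale_part Y i t w :=
  \sum_(s < t) (Y i s.+1 \- rho s (Y i s.+1)) w.

(** For a Bellman solution, each summand is the excess cost of staying in mode [i] for one step over
    deciding optimally. *)
Definition increasing_part Y i t w :=
  \sum_(s < t) (rho s (g i s \+ Y i s.+1) \- Y i s) w.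

Lemma increment_sum (X : nat -> Omega -> R) t :
  increment (fun t w => \sum_(s < t) X s w) t = X t.
Proof.
by apply/funext => w; rewrite /increment /= big_ord_recr /= addrAC subrr add0r.
Qed.

Lemma bellman_solution Y : (forall i, bounded_adapted P T G (Y i)) ->
  bellman Y ->
  is_solution P T G rho g c Y (martingale_part Y) (increasing_part Y).
Proof.
move=> LY bY.
have GS s t : (s <= t <= T)%N -> G s `<=` G t by exact: hG.2.
have LYS i t : (t < T)%N -> Linfty P (Y i t.+1) by move=> tT; have [] := LY i _ tT.
have LdM i t : (t < T)%N ->
    Linfty_wrt P (G t.+1) (Y i t.+1 \- rho t (Y i t.+1)).
  move=> tT; apply: Linfty_wrtB; first exact: LY.
  apply: (Linfty_wrtS (GS t _ _)); first by rewrite leqnSn.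
  by apply: (rho_Linfty_wrt hrho); [exact: ltnW|exact: LYS].
have LgY i t : (t < T)%N -> Linfty P (g i t \+ Y i t.+1).
  by move=> tT; apply: LinftyD; [exact: hg (ltnW tT)|exact: LYS].
have LdA i t : (t < T)%N ->
    Linfty_wrt P (G t) (rho t (g i t \+ Y i t.+1) \- Y i t).
  move=> tT; apply: Linfty_wrtB; last exact: LY (ltnW tT).
  by apply: (rho_Linfty_wrt hrho); [exact: ltnW|exact: LgY].
have LM i : bounded_adapted P T G (martingale_part Y i).
  move=> t tT.
  apply: (@Linfty_wrt_sum _ _ _ P _ (fun s => Y i s.+1 \- rho s (Y i s.+1))) => s st.
  by apply: (Linfty_wrtS (GS s.+1 t _)); [rewrite st|apply: LdM; exact: leq_trans tT].
(* The sum at [t.+1] has only terms with [s <= t], each known at time [s], whence predictability. *)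
have LAS i t : (t < T)%N -> Linfty_wrt P (G t) (increasing_part Y i t.+1).
  move=> tT.
  apply: (@Linfty_wrt_sum _ _ _ P _
    (fun s => rho s (g i s \+ Y i s.+1) \- Y i s)) => s; rewrite ltnS => st.
  apply: (Linfty_wrtS (GS s t _)); first by rewrite st ltnW.
  by apply: LdA; exact: leq_ltn_trans tT.
have LA i : bounded_adapted P T G (increasing_part Y i).
  case=> [_|t tT]; first by apply: (@Linfty_wrt_sum _ _ _ P _
    (fun s => rho s (g i s \+ Y i s.+1) \- Y i s)).
  by apply: Linfty_wrtS (LAS i t tT); apply: GS; rewrite leqnSn.
have dM i t : increment (martingale_part Y i) t = Y i t.+1 \- rho t (Y i t.+1).
  exact: (increment_sum (fun s => Y i s.+1 \- rho s (Y i s.+1))).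
have dA i t :
    increment (increasing_part Y i) t = rho t (g i t \+ Y i t.+1) \- Y i t.
  exact: (increment_sum (fun s => rho s (g i s \+ Y i s.+1) \- Y i s)).
have leY i t : (t <= T)%N ->
    \forall w \ae P, ((Y i t w)%:E <= obstacle T rho g c Y i t w)%E.
  move=> tT; apply: filterS (bY i t tT) => w ->.
  by rewrite (min_over_D1 i) ge_min lexx orbT.
(* Staying is one of the options in the Bellman minimum. *)
have ndA i t : (t < T)%N ->
    \forall w \ae P, 0 <= increment (increasing_part Y i) t w.
  move=> tT; rewrite dA.
  apply: filterS2 (bellman_le bY i i (ltnW tT)) (continuation_diag LY i tT).
  by move=> w + eqd; rewrite eqd subr_ge0.
(* The compensator [rho t (Y i t.+1)] is [G t]-measurable and leaves [rho t] by translation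
   invariance. *)
have rho_gdM i t : (t < T)%N -> \forall w \ae P,
    rho t (g i t \+ increment (martingale_part Y i) t) w =
    rho t (g i t \+ Y i t.+1) w - rho t (Y i t.+1) w.
  move=> tT; rewrite dM.
  have LNr : Linfty_wrt P (G t) (cst 0 \- rho t (Y i t.+1)).
    apply: Linfty_wrtB; first exact: Linfty_wrt_cst.
    by apply: (rho_Linfty_wrt hrho); [exact: ltnW|exact: LYS].
  have -> : g i t \+ (Y i t.+1 \- rho t (Y i t.+1)) =
      (cst 0 \- rho t (Y i t.+1)) \+ (g i t \+ Y i t.+1).
    by apply/funext => w /=; ring.
  by apply: filterS (crm_trans hrho (ltnW tT) LNr (LgY i t tT)) => w -> /=; ring.
split=> //.
- move=> i; apply/(risk_martingaleP hG hrho (LM i)) => t tT.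
  have LrN : Linfty_wrt P (G t)
      (martingale_part Y i t \- rho t (Y i t.+1)).
    apply: Linfty_wrtB; first exact: LM (ltnW tT).
    by apply: (rho_Linfty_wrt hrho); [exact: ltnW|exact: LYS].
  have -> : martingale_part Y i t.+1 =
      (martingale_part Y i t \- rho t (Y i t.+1)) \+ Y i t.+1.
    by apply/funext => w; rewrite /martingale_part /= big_ord_recr /=; ring.
  by apply: filterS (crm_trans hrho (ltnW tT) LrN (LYS i t tT)) => w -> /=; ring.
- by move=> i t tT; apply: filterS (ndA i t tT) => w; rewrite subr_ge0.
- move=> i; split; last by move=> t tT; have [] := LAS i t tT.
  by exists 0; apply: aeW => w; rewrite /increasing_part big_ord0.
- by move=> i; apply: aeW => w; rewrite /martingale_part big_ord0.
- by move=> i; apply: aeW => w; rewrite /increasing_part big_ord0.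
split=> //.
- move=> i t tT.
  have rho_gdMT : \forall w \ae P, forall s, (s < T)%N ->
      rho s (g i s \+ increment (martingale_part Y i) s) w =
      rho s (g i s \+ Y i s.+1) w - rho s (Y i s.+1) w.
    by apply: ae_forall_lt => s; exact: rho_gdM.
  apply: filterS2 (bY i T (leqnn T)) rho_gdMT => w YT rho_gdMw.
  have -> : min_over predT (fun j => rho T (gtilde g c i j T) w) = (Y i T w)%:E.
    rewrite YT; apply: eq_bigr => j _; congr EFin.
    rewrite /continuation /next_value ltnn.
    by congr (rho T _ w); apply/funext => v /=; rewrite addr0.
  rewrite -EFinD; congr EFin.
  (* Writing the differences of [M], [A] and [Y] as sums over [t <= s < T] reduces the equation to
     an identity for each [s]. *)
  rewrite -(telescope_sumr (fun s => martingale_part Y i s w))//.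
  rewrite -(telescope_sumr (fun s => increasing_part Y i s w))//.
  rewrite -!sumrB -[LHS](subrK (Y i T w)) -opprB.
  rewrite -(telescope_sumr (fun s => Y i s w))// -sumrN addrC; congr +%R.
  apply: eq_big_nat => s /andP[_ sT]; rewrite rho_gdMw//.
  have /(congr1 (@^~ w)) /= dMw := dM i s; have /(congr1 (@^~ w)) /= dAw := dA i s.
  rewrite -[X in _ = _ - X - _]/(increment (martingale_part Y i) s w).
  rewrite -[X in _ = _ - _ - X]/(increment (increasing_part Y i) s w).
  by rewrite dMw dAw; ring.
- move=> i.
  have eqT : \forall w \ae P, forall t, (t < T)%N ->
      (((Y i t w)%:E - obstacle T rho g c Y i t w) *
        (increment (increasing_part Y i) t w)%:E = 0)%E.
    apply: ae_forall_lt => t tT.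
    apply: filterS2 (continuation_diag LY i tT) (bY i t (ltnW tT)) => w diagw.
    rewrite (min_over_D1 i) diagw dA /=.
    (* If staying attains the minimum, the increment of [A] vanishes; otherwise the value equals the
       obstacle and the slack vanishes. *)
    case: leP => [_ [->]|_]; first by rewrite subrr mule0.
    by rewrite /obstacle /continuation => <-; rewrite subee// mul0e.
  apply: filterS eqT => w eqTw; rewrite big_nat big1// => t tT; exact: eqTw.
Qed.

(** * Uniqueness of the solution *)

(** The Bellman equation determines [Y]; by [solution_increments] the increments of [M] and [A] are
    determined by [Y], and both processes start at 0. *)
Lemma solution_unique Y M A Y' M' A' :
  is_solution P T G rho g c Y M A -> is_solution P T G rho g c Y' M' A' ->
  [/\ indistinguishable P T Y' Y, indistinguishable P T M' M
    & indistinguishable P T A' A].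
Proof.
move=> sol sol'.
have eqY i t : (t <= T)%N -> \forall w \ae P, Y' i t w = Y i t w.
  apply: bellman_unique; [exact: sol_Y sol'|exact: solution_bellman sol'|
    exact: sol_Y sol|exact: solution_bellman sol].
have indist (X X' : 'I_m -> nat -> Omega -> R) :
    (forall i t, (t <= T)%N -> \forall w \ae P, X i t w = X' i t w) ->
    indistinguishable P T X X'.
  move=> XX'; apply: filter_forall => i.
  by apply: (@ae_forall_lt _ _ _ _ T.+1 (fun t w => X i t w = X' i t w)) => t;
    exact: XX'.
have eq_incr (X X' : 'I_m -> nat -> Omega -> R) :
    (forall i, \forall w \ae P, X i 0%N w = 0) ->
    (forall i, \forall w \ae P, X' i 0%N w = 0) ->
    (forall i t, (t < T)%N ->
      \forall w \ae P, increment (X i) t w = increment (X' i) t w) ->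
    indistinguishable P T X X'.
  move=> X0 X'0 dX; apply: indist => i; elim=> [_|t IHt tT].
    by apply: filterS2 (X0 i) (X'0 i) => w -> ->.
  apply: filterS2 (IHt (ltnW tT)) (dX i t tT) => w Xt.
  by rewrite /increment /= Xt => /addIr.
have LYS i t : (t < T)%N -> Linfty P (Y i t.+1).
  by move=> tT; have [] := sol_Y sol i tT.
have LYS' i t : (t < T)%N -> Linfty P (Y' i t.+1).
  by move=> tT; have [] := sol_Y sol' i tT.
split; first exact: indist.
- apply: eq_incr; [exact: sol_M0 sol'|exact: sol_M0 sol|] => i t tT.
  apply: filterS2 (filterI (solution_increments sol' i tT)
    (solution_increments sol i tT))
    (filterI (eqY i _ tT) (eq_rho hG hrho (ltnW tT) (LYS' i t tT) (LYS i t tT)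
      (eqY i _ tT))).
  by move=> w [[-> _] [-> _]] [-> ->].
- apply: eq_incr; [exact: sol_A0 sol'|exact: sol_A0 sol|] => i t tT.
  have eq_gY : \forall w \ae P,
      (g i t \+ Y' i t.+1) w = (g i t \+ Y i t.+1) w.
    by apply: filterS (eqY i _ tT) => w /= ->.
  apply: filterS2 (filterI (solution_increments sol' i tT)
    (solution_increments sol i tT))
    (filterI (eqY i _ (ltnW tT)) (eq_rho hG hrho (ltnW tT)
      (LinftyD (hg i (ltnW tT)) (LYS' i t tT))
      (LinftyD (hg i (ltnW tT)) (LYS i t tT)) eq_gY)).
  by move=> w [[_ ->] [_ ->]] [-> ->].
Qed.

End switching.

Theorem theorem2p6 (R : realType) (d : measure_display)
  (Omega : measurableType d) (P : probability Omega R)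
  (T m : nat) (G : nat -> set_system Omega)
  (rho : nat -> (Omega -> R) -> (Omega -> R))
  (g : 'I_m -> nat -> Omega -> R) (c : 'I_m -> 'I_m -> nat -> Omega -> R)
  (hG : filtration T G)
  (hrho : cond_risk_mapping P T G rho)
  (hg : forall i t, (t <= T)%N -> Linfty P (g i t))
  (hc : forall i j t, (t <= T)%N -> Linfty P (c i j t))
  (hc0 : forall i t, (t <= T)%N -> \forall w \ae P, c i i t w = 0) :
  exists Y M A : 'I_m -> nat -> Omega -> R,
    [/\ is_solution P T G rho g c Y M A,
        forall Y' M' A' : 'I_m -> nat -> Omega -> R,
          is_solution P T G rho g c Y' M' A' ->
          [/\ indistinguishable P T Y' Y, indistinguishable P T M' M
            & indistinguishable P T A' A]
      & is_value_process P T G rho g c Y].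
Proof.
pose Y := value T rho g c.
have LY : forall i, bounded_adapted P T G (Y i) by exact: value_adapted.
have bY : bellman P T rho g c Y by exact: value_bellman.
have solY := bellman_solution hG hrho hg hc hc0 LY bY.
exists Y, (martingale_part rho Y), (increasing_part rho g Y); split=> //.
- by move=> Y' M' A'; exact: solution_unique.
- exact: bellman_value_process.
Qed.
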